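(* Let $G=(V,E,w)$ be a dissimilarity instance on $|V|=n$ data points with $w_{ij}\in[0,1]$, and let $T^O$ be a binary HC tree maximizing $dis_G$. Then for any $\epsilon>0$ there exists an HC tree $\tilde T$ on $V$ such that (i) $\tilde T$ contains $\Theta(1/\epsilon^2)$ internal nodes, each with at most $3\epsilon^2 n$ children, and (ii) $dis_G(\tilde T)\ge(1-\epsilon)\,dis_G(T^O)$.
   Context: An HC tree on $V$ is a rooted tree whose leaves are in bijective correspondence with $V$. For a node $v$, $|T_v|$ is the number of data points (leaves) in the subtree rooted at $v$. For data points $i\neq j$ with lowest common ancestor $lca(i,j)$, let $v_i,v_j$ be the children of $lca(i,j)$ whose subtrees contain $i$ and $j$ respectively. The dissimilarity of an HC tree (binary or not) is $dis_G(T)=\sum_{i<j} w_{ij}(|T_{v_i}|+|T_{v_j}|)$; for binary trees this equals $\sum_{i<j} w_{ij}|T_{ij}|$, where $|T_{ij}|$ is the number of leaves below $lca(i,j)$.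
   Formalization: The formal theorem assumes ε < 1 and ε²n ≥ 1: for tiny ε²n no node may have two children, and for large ε, Θ(1/ε²) would be below one node; excluded cases where the claim still holds are trivial (T^O itself or a star). *)

(* Defs.v *)
From mathcomp Require Import all_boot all_order all_algebra.
Set Implicit Arguments. Unset Strict Implicit. Unset Printing Implicit Defensive.
Import Order.TTheory GRing.Theory Num.Theory.

Inductive hctree (n : nat) : Type :=
| Leaf of 'I_n
| Node of seq (hctree n).

Arguments Leaf {n}.
Arguments Node {n}.

Fixpoint leaves n (t : hctree n) : seq 'I_n :=
  match t with
  | Leaf v => [:: v]
  | Node ts => flatten (map (@leaves n) ts)
  end.

Fixpoint all_nodes n (P : seq (hctree n) -> bool) (t : hctree n) : bool :=
  match t with
  | Leaf _ => true
  | Node ts => P ts && all (all_nodes P) ts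
  end.

Fixpoint n_internal n (t : hctree n) : nat :=
  match t with
  | Leaf _ => 0
  | Node ts => (sumn (map (@n_internal n) ts)).+1
  end.

Definition is_hctree n (t : hctree n) : Prop :=
  all_nodes (fun ts => 1 < size ts)%N t /\ perm_eq (leaves t) (enum 'I_n).

Definition is_binary_hctree n (t : hctree n) : Prop :=
  is_hctree t /\ all_nodes (fun ts => size ts == 2)%N t.

(* For i <> j: |T_{v_i}| + |T_{v_j}|, where v_i, v_j are the children of
   lca(i,j) containing i and j respectively. *)
Fixpoint lca_weight n (t : hctree n) (i j : 'I_n) : nat :=
  match t with
  | Leaf _ => 0
  | Node ts =>
      if has (fun c => (i \in leaves c) && (j \in leaves c)) ts then
        sumn (map (fun c => if (i \in leaves c) && (j \in leaves c)
                            then lca_weight c i j else 0) ts)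
      else
        sumn (map (fun c => if i \in leaves c then size (leaves c) else 0) ts)
        + sumn (map (fun c => if j \in leaves c then size (leaves c) else 0) ts)
  end%N.

Definition dis (R : numDomainType) n (w : 'I_n -> 'I_n -> R) (t : hctree n) : R :=
  (\sum_(i < n) \sum_(j < n | (i < j)%N) w i j * (lca_weight t i j)%:R)%R.

(* Main.v *)
Require Import Defs.
From mathcomp Require Import all_boot all_order all_algebra.
From mathcomp Require Import zify ring lra.
Import Order.TTheory GRing.Theory Num.Theory.
Set Implicit Arguments. Unset Strict Implicit. Unset Printing Implicit Defensive.
Local Open Scope ring_scope.

(* Write W for the total weight. Cutting a bipartition of weight at least W/2 at
   the root gives dis TO >= n W / 2, so a tree may lose up to eps n / 2 on each
   unit of weight. Walk down TO and collect in a set S the leaves of the subtrees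
   with at most s ~ eps n / 12 leaves that hang off the current path. As soon as
   |S| > s, or both subtrees below have more than s leaves, flush S: split it into
   O(1/eps) pieces of at most eps^2 n leaves whose total inner weight is at most
   an eps/4 fraction of the weight inside S, and attach the pieces one after the
   other, as stars, above the tree built for the rest. A pair meeting S then loses
   at most |S| <= 2 s, unless it lies inside a piece. There are O(1/eps) flushes,
   hence O(1/eps^2) internal nodes. The lower bound on their number holds for
   every tree with n leaves whose nodes have at most eps^2 n + 1 children. *)

(** * Rooted trees: induction, leaf counts and [lca_weight] *)

Section Trees.
Variable n : nat.
Implicit Types (t l r : hctree n) (ts : seq (hctree n)) (p S : seq 'I_n).

(** The generated principle gives no hypothesis for the trees in a list of children; the [foldr]
    conjunction supplies one per child. *)
Lemma hctree_nested_ind (P : hctree n -> Prop) :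
  (forall v, P (Leaf v)) ->
  (forall ts, foldr (fun t Q => P t /\ Q) True ts -> P (Node ts)) ->
  forall t, P t.
Proof.
move=> HL HN; fix IH 1 => -[v|ts]; first exact: HL.
by apply: HN; elim: ts => [|t ts IHts] /=; [exact: I | split; [exact: IH |]].
Qed.

Lemma all_nodes_sub (P Q : seq (hctree n) -> bool) t :
  (forall ts, P ts -> Q ts) -> all_nodes P t -> all_nodes Q t.
Proof.
move=> PQ; elim/hctree_nested_ind: t => [//|ts IH] /= /andP[/PQ-> /=].
by elim: ts IH => [//|t ts IHts] /= [IHt /IHts{}IH] /andP[/IHt-> /IH].
Qed.

(** Turning a leaf into a node with at most [k.+1] children adds at most [k] leaves. This yields the
    lower bound on the number of internal nodes. *)
Lemma leaf_count_le k t :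
  all_nodes (fun ts => size ts <= k.+1)%N t ->
  (size (leaves t) <= 1 + k * n_internal t)%N.
Proof.
elim/hctree_nested_ind: t => [//|ts IH] /= /andP[size_ts ok_ts].
suff: (size (flatten (map (@leaves n) ts)) <=
       size ts + k * sumn (map (@n_internal n) ts))%N by lia.
elim: ts IH ok_ts {size_ts} => [|t ts IHts] /=; first lia.
by rewrite size_cat => -[IHt /IHts{}IH] /andP[/IHt ? /IH]; lia.
Qed.

Definition binary t := all_nodes (fun ts => size ts == 2)%N t.

Lemma binary_ind (P : hctree n -> Prop) :
  (forall v, P (Leaf v)) ->
  (forall l r, binary l -> binary r -> P l -> P r -> P (Node [:: l; r])) ->
  forall t, binary t -> P t.
Proof.
move=> HL HN; elim/hctree_nested_ind=> [v _|[|l [|r []]] //= [Pl [Pr _]]] //.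
by rewrite /binary /= andbT => /andP[bl br]; apply: HN; auto.
Qed.

Definition star t p : hctree n := Node (t :: map Leaf p).

Lemma leaves_map_Leaf p : flatten (map (@leaves n) (map Leaf p)) = p.
Proof. by elim: p => //= v p ->. Qed.

Lemma leaves_star t p : leaves (star t p) = leaves t ++ p.
Proof. by rewrite /= leaves_map_Leaf. Qed.

Lemma all_nodes_Leafs (P : seq (hctree n) -> bool) p :
  all (all_nodes P) (map Leaf p).
Proof. by elim: p. Qed.

Lemma n_internal_star t p : n_internal (star t p) = (n_internal t).+1.
Proof. by rewrite /=; congr _.+1; elim: p => [|v p] //=; lia. Qed.

Lemma sumn_map0 (F : hctree n -> nat) ts :
  all (fun c => F c == 0)%N ts -> sumn (map F ts) = 0%N.
Proof. by elim: ts => //= c ts IH /andP[/eqP-> /IH->]. Qed.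

Lemma notin_leaves i ts :
  i \notin flatten (map (@leaves n) ts) -> all (fun c => i \notin leaves c) ts.
Proof. by elim: ts => //= c ts IH; rewrite mem_cat negb_or => /andP[-> /IH]. Qed.

Lemma lca_weight_head t ts i j :
  i \in leaves t -> j \in leaves t -> i \notin flatten (map (@leaves n) ts) ->
  lca_weight (Node (t :: ts)) i j = lca_weight t i j.
Proof.
move=> it jt /notin_leaves its /=; rewrite it jt /= sumn_map0 ?addn0 //.
by apply: sub_all its => c /negbTE->.
Qed.

Lemma lca_weight_cross t ts i j :
  i \in leaves t -> i \notin flatten (map (@leaves n) ts) -> j \notin leaves t ->
  lca_weight (Node (t :: ts)) i j =
  (size (leaves t) +
   sumn (map (fun c => if j \in leaves c then size (leaves c) else 0) ts))%N.
Proof.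
move=> it /notin_leaves its jt /=; rewrite it (negbTE jt) /= ifN; last first.
  by rewrite -all_predC; apply: sub_all its => c /= /negbTE->.
rewrite [X in (_ + X + _)%N]sumn_map0 ?addn0 //.
by apply: sub_all its => c /negbTE->.
Qed.

Lemma lca_weight_cross_sym t ts i j :
  i \in leaves t -> i \notin flatten (map (@leaves n) ts) -> j \notin leaves t ->
  lca_weight (Node (t :: ts)) j i = lca_weight (Node (t :: ts)) i j.
Proof.
move=> it its jt; rewrite (lca_weight_cross it its jt).
move/notin_leaves: its => its /=; rewrite it (negbTE jt) /= ifN; last first.
  by rewrite -all_predC; apply: sub_all its => c /= /negbTE->; rewrite andbF.
rewrite [X in (_ + (_ + X))%N]sumn_map0 ?addn0 1?addnC //.
by apply: sub_all its => c /negbTE->.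
Qed.

Lemma lca_weight_right l r i j :
  i \in leaves r -> j \in leaves r -> i \notin leaves l ->
  lca_weight (Node [:: l; r]) i j = lca_weight r i j.
Proof. by move=> ir jr il; rewrite /= ir jr (negbTE il) /= addn0. Qed.

(** The lca of two distinct leaves of a binary tree has just two children, so the weight is the size
    of the subtree there. *)
Lemma lca_weight_le t i j :
  binary t -> uniq (leaves t) -> i \in leaves t -> j \in leaves t ->
  (lca_weight t i j <= size (leaves t))%N.
Proof.
move=> bt; move: t bt; apply: binary_ind => [//|l r _ _ IHl IHr].
have -> : leaves (Node [:: l; r]) = leaves l ++ leaves r by rewrite /= cats0.
rewrite cat_uniq size_cat => /and3P[ul dis_lr ur].
have nlr k : k \in leaves r -> k \notin leaves l.
  by move=> kr; apply: contra dis_lr => kl; apply/hasP; exists k.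
have nrl k : k \in leaves l -> k \notin flatten [seq leaves t | t <- [:: r]].
  by rewrite /= cats0; apply: contraL => /nlr.
rewrite !mem_cat => /orP[il|ir] /orP[jl|jr].
- by rewrite lca_weight_head ?nrl //; have := IHl ul il jl; lia.
- by rewrite lca_weight_cross ?nrl ?nlr //= jr addn0.
- by rewrite lca_weight_cross_sym ?nrl ?nlr // lca_weight_cross ?nrl ?nlr //= ir addn0.
- by rewrite lca_weight_right ?nlr //; have := IHr ur ir jr; lia.
Qed.

End Trees.

(** Averaging: at least [q] free elements with [q%:R * F x > c] would push the total of [F] above
    [c]. *)
Lemma has_cheap (R : realFieldType) (T : eqType) (free : pred T) (F : T -> R)
    (s : seq T) (q : nat) (c : R) :
  (0 < q <= count free s)%N -> (forall x, 0 <= F x) -> \sum_(x <- s) F x <= c ->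
  has (fun x => free x && (q%:R * F x <= c)) s.
Proof.
move=> /andP[q_gt0 q_le] F_ge0 sum_c.
rewrite -[has _ _]negbK -all_predC; apply/negP => /allP/= dear.
have c_ge0 : 0 <= c by apply: le_trans sum_c; apply: sumr_ge0.
have: \sum_(x <- [seq x <- s | free x]) c
        < \sum_(x <- [seq x <- s | free x]) q%:R * F x.
  rewrite big_seq [ltRHS]big_seq; apply: ltr_sum => [|x].
    apply/hasP; case: filter (size_filter free s) => [/=|x ? _]; first lia.
    by exists x; rewrite ?mem_head.
  by rewrite mem_filter => /andP[free_x /dear]; rewrite free_x /= -ltNge.
apply/negP; rewrite -leNgt -mulr_sumr big_const_seq count_predT iter_addr_0.
rewrite size_filter -[c *+ _]mulr_natl.
apply: (@le_trans _ _ (q%:R * c)); last by apply: ler_wpM2r; rewrite ?ler_nat.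
apply: ler_wpM2l => //; apply: le_trans sum_c.
by rewrite big_filter [leRHS](bigID free) /= lerDl sumr_ge0.
Qed.

(** * Weights of leaf lists, and the effect of stars on the dissimilarity *)

Section Weights.
Variables (R : realFieldType) (n : nat) (u : 'I_n -> 'I_n -> R).
Hypothesis u_ge0 : forall i j, 0 <= u i j.
Hypothesis u_diag : forall i, u i i = 0.
Implicit Types (A B S p : seq 'I_n) (t l r : hctree n).

(** Both orders are summed because [u] will vanish unless [i < j]; each unordered pair is then
    counted once. *)
Definition cross A B : R := \sum_(i <- A) \sum_(j <- B) (u i j + u j i).

Definition inner A : R := \sum_(i <- A) \sum_(j <- A) u i j.

Definition tree_dis t : R :=
  \sum_(i <- leaves t) \sum_(j <- leaves t) u i j * (lca_weight t i j)%:R.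

Lemma cross_ge0 A B : 0 <= cross A B.
Proof. by do 2![apply: sumr_ge0 => ? _]; rewrite addr_ge0. Qed.

Lemma inner_ge0 A : 0 <= inner A.
Proof. by do 2![apply: sumr_ge0 => ? _]. Qed.

Lemma inner_perm A B : perm_eq A B -> inner A = inner B.
Proof.
move=> AB; rewrite /inner (perm_big _ AB) /=.
by apply: eq_bigr => i _; apply: perm_big.
Qed.

Lemma inner_cat A B : inner (A ++ B) = inner A + inner B + cross A B.
Proof.
rewrite /inner /cross big_cat /=.
under eq_bigr do rewrite big_cat /=.
under [X in _ + X = _]eq_bigr do rewrite big_cat /=.
rewrite !big_split /=; under [X in _ = _ + X]eq_bigr do rewrite big_split /=.
by rewrite big_split /= [\sum_(i <- B) \sum_(j <- A) _]exchange_big /=; ring.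
Qed.

Lemma crossC A B : cross A B = cross B A.
Proof.
rewrite /cross exchange_big /=.
by under eq_bigr do under eq_bigr do rewrite addrC.
Qed.

Lemma cross_perm A A' B B' :
  perm_eq A A' -> perm_eq B B' -> cross A B = cross A' B'.
Proof.
move=> AA' BB'; rewrite /cross (perm_big _ AA') /=.
by apply: eq_bigr => i _; apply: perm_big.
Qed.

Lemma inner_nil : inner [::] = 0.
Proof. by rewrite /inner big_nil. Qed.

Lemma inner1 i : inner [:: i] = 0.
Proof. by rewrite /inner !big_seq1. Qed.

Lemma inner_cons i A : inner (i :: A) = inner A + cross [:: i] A.
Proof. by rewrite -cat1s inner_cat inner1 add0r. Qed.

Lemma tree_dis_ge0 t : 0 <= tree_dis t.
Proof. by do 2![apply: sumr_ge0 => ? _]; rewrite mulr_ge0. Qed.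

Lemma tree_dis_le t : binary t -> uniq (leaves t) ->
  tree_dis t <= inner (leaves t) * (size (leaves t))%:R.
Proof.
move=> bt ut; rewrite /tree_dis /inner mulr_suml big_seq [leRHS]big_seq.
apply: ler_sum => i it; rewrite mulr_suml big_seq [leRHS]big_seq.
by apply: ler_sum => j jt; rewrite ler_wpM2l // ler_nat lca_weight_le.
Qed.

Lemma tree_dis_star t p : uniq (leaves t ++ p) ->
  tree_dis t + cross (leaves t) p * (size (leaves t))%:R
    <= tree_dis (star t p).
Proof.
rewrite cat_uniq => /and3P[ut dis_tp up].
have npt k : k \in p -> k \notin leaves t.
  by move=> kp; apply: contra dis_tp => kt; apply/hasP; exists k.
have ntp k : k \in leaves t -> k \notin flatten (map (@leaves n) (map Leaf p)).
  by rewrite leaves_map_Leaf; apply: contraL => /npt.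
have Lhead i j : i \in leaves t -> j \in leaves t ->
    lca_weight (star t p) i j = lca_weight t i j.
  by move=> it jt; rewrite /star lca_weight_head ?ntp.
have Lsym i j : i \in leaves t -> j \in p ->
    lca_weight (star t p) j i = lca_weight (star t p) i j.
  by move=> it jp; rewrite /star lca_weight_cross_sym ?ntp ?npt.
have Lcross i j : i \in leaves t -> j \in p ->
    (size (leaves t) <= lca_weight (star t p) i j)%N.
  by move=> it jp; rewrite /star lca_weight_cross ?ntp ?npt // leq_addr.
rewrite /tree_dis leaves_star.
move: (lca_weight (star t p)) Lhead Lsym Lcross => L Lhead Lsym Lcross.
rewrite big_cat /=.
under [X in _ <= X + _]eq_bigr do rewrite big_cat /=.
under [X in _ <= _ + X]eq_bigr do rewrite big_cat /=.
rewrite !big_split /= -addrA lerD //.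
  rewrite big_seq [leRHS]big_seq; apply: ler_sum => i it.
  by rewrite big_seq [leRHS]big_seq; apply: ler_sum => j jt; rewrite Lhead.
(* The pairs inside [p] are bounded below by 0. *)
rewrite addrA -[leLHS]addr0 lerD //; last first.
  by do 2![apply: sumr_ge0 => ? _]; rewrite mulr_ge0.
rewrite [X in _ <= _ + X]exchange_big -big_split mulr_suml /=.
rewrite big_seq [leRHS]big_seq; apply: ler_sum => i it.
rewrite mulr_suml -big_split big_seq [leRHS]big_seq; apply: ler_sum => j jp /=.
by rewrite (Lsym i j) // -mulrDl ler_wpM2l ?addr_ge0 // ler_nat Lcross.
Qed.

Lemma leaves_node2 l r : leaves (Node [:: l; r]) = leaves l ++ leaves r.
Proof. by rewrite /= cats0. Qed.

Lemma tree_dis_node2 l r : uniq (leaves l ++ leaves r) ->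
  tree_dis (Node [:: l; r]) =
  tree_dis l + tree_dis r
    + cross (leaves l) (leaves r) * (size (leaves l) + size (leaves r))%:R.
Proof.
rewrite cat_uniq => /and3P[ul dis_lr ur].
have nrl k : k \in leaves r -> k \notin leaves l.
  by move=> kr; apply: contra dis_lr => kl; apply/hasP; exists k.
have nlr k : k \in leaves l -> k \notin flatten (map (@leaves n) [:: r]).
  by rewrite /= cats0; apply: contraL => /nrl.
pose lr := Node [:: l; r].
have Lleft i j : i \in leaves l -> j \in leaves l ->
    lca_weight lr i j = lca_weight l i j.
  by move=> il jl; rewrite /lr lca_weight_head ?nlr.
have Lright i j : i \in leaves r -> j \in leaves r ->
    lca_weight lr i j = lca_weight r i j.
  by move=> ir jr; rewrite /lr lca_weight_right ?nrl.
have Lsym i j : i \in leaves l -> j \in leaves r ->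
    lca_weight lr j i = lca_weight lr i j.
  by move=> il jr; rewrite /lr lca_weight_cross_sym ?nlr ?nrl.
have Lcross i j : i \in leaves l -> j \in leaves r ->
    lca_weight lr i j = (size (leaves l) + size (leaves r))%N.
  by move=> il jr; rewrite /lr lca_weight_cross ?nlr ?nrl //= jr addn0.
rewrite -/lr /tree_dis leaves_node2.
move: (lca_weight lr) Lleft Lright Lsym Lcross => L Lleft Lright Lsym Lcross.
rewrite big_cat /=.
under [X in X + _ = _]eq_bigr do rewrite big_cat /=.
under [X in _ + X = _]eq_bigr do rewrite big_cat /=.
rewrite !big_split /= -!addrA; congr (_ + _).
  rewrite big_seq [RHS]big_seq; apply: eq_bigr => i il.
  by rewrite big_seq [RHS]big_seq; apply: eq_bigr => j jl; rewrite Lleft.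
rewrite addrA [RHS]addrC; congr (_ + _); last first.
  rewrite big_seq [RHS]big_seq; apply: eq_bigr => i ir.
  by rewrite big_seq [RHS]big_seq; apply: eq_bigr => j jr; rewrite Lright.
rewrite [X in _ + X]exchange_big -big_split mulr_suml /=.
rewrite big_seq [RHS]big_seq; apply: eq_bigr => i il.
rewrite mulr_suml -big_split big_seq [RHS]big_seq; apply: eq_bigr => j jr /=.
by rewrite (Lsym i j) // -mulrDl Lcross.
Qed.

(* Greedy: fewer than d + 1 of the d + q pieces are full, so at least q pieces
   can receive i, and the cheapest of them costs at most a q-th of the weight
   between i and everything placed so far. *)
Lemma balanced_pieces (d q k : nat) S :
  (0 < q)%N -> (size S <= d.+1 * k)%N ->
  exists ps : seq (seq 'I_n),
    [/\ size ps = (d + q)%N, perm_eq (flatten ps) S,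
        all (fun p => size p <= k)%N ps
      & q%:R * (\sum_(p <- ps) inner p) <= inner S].
Proof.
move=> q_gt0; elim: S => [_|i S IH sizeS].
  exists (nseq (d + q) [::]); split; rewrite ?size_nseq //.
  - by elim: (d + q)%N.
  - by rewrite all_nseq orbT.
  by rewrite big_nseq inner_nil iter_addr_0 mul0rn mulr0.
have [|ps [size_ps perm_ps ps_k ps_E]] := IH; first by move: sizeS => /=; lia.
pose free p := (size p < k)%N.
(* The inequality [size S < d.+1 * k] is strict because [i] is still to be placed; hence at most [d]
   pieces are full. *)
have free_q : (q <= count free ps)%N.
  have := count_predC free ps; rewrite size_ps.
  suff: (k * count (predC free) ps <= size S)%N by move: sizeS => /=; nia.
  rewrite -(perm_size perm_ps) size_flatten /shape.
  elim: ps {size_ps perm_ps ps_k ps_E} => [|p ps IHps] /=; first by rewrite muln0.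
  by rewrite mulnDr leq_add //; rewrite /free -leqNgt; case: leqP; lia.
have crossS : \sum_(p <- ps) cross [:: i] p = cross [:: i] S.
  rewrite /cross !big_seq1 -(perm_big _ perm_ps) /= big_flatten /=.
  by apply: eq_bigr => p _; rewrite big_seq1.
have /hasP[p p_ps /andP[p_free p_cheap]] :
    has (fun p => free p && (q%:R * cross [:: i] p <= cross [:: i] S)) ps.
  apply: has_cheap; rewrite ?q_gt0 ?crossS //.
  by move=> p; apply: cross_ge0.
case/splitPr: p_ps size_ps perm_ps ps_k ps_E => ps1 ps2.
rewrite size_cat /= flatten_cat /= all_cat /= big_cat big_cons /=.
move=> size_ps perm_ps /and3P[ps1_k p_k ps2_k] ps_E.
exists (ps1 ++ (i :: p) :: ps2); split.
- by rewrite size_cat.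
- rewrite flatten_cat /= -[i :: p ++ _]cat1s perm_catCA /=.
  by rewrite perm_cons.
- by rewrite all_cat /= ps1_k ps2_k andbT; exact: p_free.
- rewrite big_cat big_cons /= !inner_cons; move: ps_E p_cheap.
  by rewrite !mulrDr; lra.
Qed.

(** An empty piece is skipped, since its star would be a node with a single child. *)
Definition pieces_tree (ps : seq (seq 'I_n)) t : hctree n :=
  foldr (fun p t' => if p is [::] then t' else star t' p) t ps.

Lemma pieces_tree_perm ps t :
  perm_eq (leaves (pieces_tree ps t)) (flatten ps ++ leaves t).
Proof.
elim: ps => [//|p ps IH] /=; case: p => [//|i p].
by rewrite leaves_star perm_catC -catA perm_cat2l.
Qed.

Lemma pieces_tree_all_nodes (P : seq (hctree n) -> bool) k ps t :
  (forall ts, (1 < size ts <= k.+1)%N -> P ts) ->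
  all (fun p => size p <= k)%N ps -> all_nodes P t ->
  all_nodes P (pieces_tree ps t).
Proof.
move=> Pok + Pt; elim: ps => [//|[|i p] ps IH] //= /andP[p_k /IH-> /=].
by rewrite all_nodes_Leafs andbT Pok //= size_map.
Qed.

Lemma pieces_tree_n_internal ps t :
  (n_internal (pieces_tree ps t) <= size ps + n_internal t)%N.
Proof.
elim: ps => [//|[|i p] ps IH] /=; first by lia.
by rewrite -[X in (X <= _)%N]/(n_internal (star _ (i :: p))) n_internal_star.
Qed.

(** The difference in parentheses is the weight of the pairs that meet a piece without lying inside
    one. Such a pair is separated at a star above [t], so it keeps at least [size (leaves t)]. *)
Lemma pieces_tree_dis ps t : uniq (flatten ps ++ leaves t) ->
  tree_dis t + (inner (flatten ps ++ leaves t) - inner (leaves t)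
    - \sum_(p <- ps) inner p) * (size (leaves t))%:R
    <= tree_dis (pieces_tree ps t).
Proof.
elim: ps => [_|p ps IH] /=; first by rewrite big_nil; lra.
rewrite -catA big_cons inner_cat => /[dup] upt.
rewrite cat_uniq => /and3P[_ _ /IH{}IH].
have perm_T := pieces_tree_perm ps t.
set T := pieces_tree ps t in IH perm_T *.
have uT : uniq (leaves T ++ p).
  rewrite uniq_catC (perm_uniq (_ : perm_eq _ (p ++ flatten ps ++ leaves t))) //.
  by rewrite perm_cat2l.
have crossT : cross p (flatten ps ++ leaves t) = cross (leaves T) p.
  by rewrite crossC; apply: cross_perm; rewrite // perm_sym.
have sizeT : (size (leaves t) <= size (leaves T))%N.
  by rewrite (perm_size perm_T) size_cat leq_addl.
rewrite crossT.
have step : tree_dis T + cross (leaves T) p * (size (leaves t))%:R <=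
    tree_dis (if p is [::] then T else star T p).
  case: p {upt crossT} uT => [_|i p uT].
    rewrite /cross; under eq_bigr do rewrite big_nil.
    by rewrite big1 // mul0r addr0.
  apply: le_trans (tree_dis_star uT); rewrite lerD2l.
  by rewrite ler_wpM2l ?cross_ge0 // ler_nat.
by apply: le_trans step; nra.
Qed.

Lemma flush_pieces (P : seq (hctree n) -> bool) (d q k : nat) S t :
  (0 < q)%N -> (size S <= d.+1 * k)%N -> uniq (S ++ leaves t) ->
  (forall ts, (1 < size ts <= k.+1)%N -> P ts) -> all_nodes P t ->
  exists T : hctree n,
    [/\ perm_eq (leaves T) (S ++ leaves t), all_nodes P T,
        (n_internal T <= d + q + n_internal t)%N
      & tree_dis t + (inner (S ++ leaves t) - inner (leaves t)
          - inner S / q%:R) * (size (leaves t))%:R <= tree_dis T].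
Proof.
move=> q_gt0 sizeS uSt Pok Pt.
have [ps [size_ps perm_ps ps_k ps_E]] := balanced_pieces q_gt0 sizeS.
have perm_pst : perm_eq (flatten ps ++ leaves t) (S ++ leaves t).
  by rewrite perm_cat2r.
exists (pieces_tree ps t); split.
- exact: perm_trans (pieces_tree_perm ps t) perm_pst.
- exact: pieces_tree_all_nodes Pok ps_k Pt.
- by rewrite -size_ps pieces_tree_n_internal.
rewrite -(inner_perm perm_pst); apply: le_trans (pieces_tree_dis _); last first.
  by rewrite (perm_uniq perm_pst).
rewrite lerD2l ler_wpM2r // lerD2l lerN2 ler_pdivlMr ?ltr0n //.
by rewrite mulrC.
Qed.

End Weights.

(** * Compression of a binary tree *)

Section Compression.
Variables (R : realFieldType) (n : nat) (u : 'I_n -> 'I_n -> R).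
Hypothesis u_ge0 : forall i j, 0 <= u i j.
Hypothesis u_diag : forall i, u i i = 0.
(** [s] bounds the small subtrees and the pending leaves, [k] the piece size, [d + q] the number of
    pieces, [lam] the loss per unit of weight. The factor 3 covers [s] pending leaves and two
    subtrees of at most [s] leaves each. *)
Variables (P : seq (hctree n) -> bool) (d q k s : nat) (lam : R).
Hypothesis q_gt0 : (0 < q)%N.
Hypothesis s_le : (3 * s <= d.+1 * k)%N.
Hypothesis P_le : forall ts, (1 < size ts <= k.+1)%N -> P ts.
Hypothesis P_pair : forall l r, P [:: l; r].
Hypothesis lam_ge : 3 * s%:R + n%:R / q%:R <= lam.
Implicit Types (S : seq 'I_n) (t l r T : hctree n).

Local Notation inner := (inner u).
Local Notation cross := (cross u).
Local Notation tree_dis := (tree_dis u).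

(* The dissimilarity that t and the pending leaves S account for, where S was
   cut off above t: a pair meeting S weighs at most size (S ++ leaves t) in the
   original tree. *)
Definition pending_dis S t : R :=
  tree_dis t + (inner (S ++ leaves t) - inner (leaves t)) * (size (S ++ leaves t))%:R.

Definition compressed S t T : Prop :=
  [/\ perm_eq (leaves T) (S ++ leaves t), all_nodes P T
    & pending_dis S t <= tree_dis T + lam * inner (S ++ leaves t)].

(** With K = d + q + 1 and m leaves in all, [n_internal T] is at most K (2m / (s + 1) - 1). When two
    subtrees are joined, the spare K of one of them pays for the joining node and a flush. *)
Definition few_internal S t T : Prop :=
  (s.+1 * (n_internal T + (d + q).+1) <= 2 * (d + q).+1 * size (S ++ leaves t))%N.

Lemma pending_dis_nil t : pending_dis [::] t = tree_dis t.
Proof. by rewrite /pending_dis subrr mul0r addr0. Qed.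

Lemma lam_ge3s : 3 * s%:R <= lam.
Proof. by apply: le_trans lam_ge; rewrite lerDl divr_ge0. Qed.

Lemma size_uniq_le S : uniq S -> (size S <= n)%N.
Proof. by move=> uS; rewrite -[n in (_ <= n)%N]card_ord -(card_uniqP uS) max_card. Qed.

(** A pair meeting [S] but not inside a piece loses at most [size S], hence at most [2 * s]. The
    pairs inside pieces carry at most [inner S / q%:R] and may lose up to [n] more each. Both losses
    fit into [lam]. *)
Lemma flush_compressed S t T0 :
  (size S <= 2 * s)%N -> uniq (S ++ leaves t) -> compressed [::] t T0 ->
  exists2 T, compressed S t T & (n_internal T <= d + q + n_internal T0)%N.
Proof.
move=> size_S uS [/= perm_T0 P_T0 dis_T0].
have perm_S : perm_eq (S ++ leaves T0) (S ++ leaves t) by rewrite perm_cat2l.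
have size_Sk : (size S <= d.+1 * k)%N by lia.
have uS0 : uniq (S ++ leaves T0) by rewrite (perm_uniq perm_S).
have [T [perm_T P_T size_T dis_T]] :=
  flush_pieces u_ge0 u_diag q_gt0 size_Sk uS0 P_le P_T0.
exists T => //; split=> //; first exact: perm_trans perm_T perm_S.
move: dis_T dis_T0; rewrite pending_dis_nil /pending_dis.
rewrite (inner_perm _ perm_S) (inner_perm _ perm_T0) (perm_size perm_T0).
rewrite size_cat natrD inner_cat.
have eS_ge0 := inner_ge0 u_ge0 S; have c_ge0 := cross_ge0 u_ge0 S (leaves t).
have a_le : (size S)%:R <= 2 * s%:R :> R by rewrite -natrM ler_nat.
have b_le : (size (leaves t))%:R <= n%:R :> R.
  by rewrite ler_nat size_uniq_le //; move: uS; rewrite cat_uniq => /and3P[].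
have r_ge0 : 0 <= (q%:R : R)^-1 by rewrite invr_ge0.
move: lam_ge (ler0n R s) (ler0n R n) eS_ge0 c_ge0 a_le b_le r_ge0.
move: (inner S) (inner (leaves t)) (cross _ _) (tree_dis t) (tree_dis T)
  (tree_dis T0) (size S)%:R (size (leaves t))%:R s%:R n%:R (q%:R^-1).
move=> eS et c dt dT dT0 a b sg N r lam_le sg_ge0 N_ge0 eS_ge0 c_ge0 a_le b_le r_ge0.
have ec_ge0 : 0 <= eS + c by rewrite addr_ge0.
(* These products carry the nonlinear part; once they are expanded, the estimate is linear in the
   monomials. *)
have : 0 <= (eS + c) * (lam - (3 * sg + N * r)) by rewrite mulr_ge0 ?subr_ge0.
have : 0 <= (eS + c) * (2 * sg - a) by rewrite mulr_ge0 ?subr_ge0.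
have : 0 <= (eS + c) * sg by rewrite mulr_ge0.
have : 0 <= eS * r * (N - b) by rewrite mulr_ge0 ?subr_ge0 // mulr_ge0.
have : 0 <= c * r * N by rewrite !mulr_ge0.
by rewrite !(mulrDl, mulrDr, mulrBl, mulrBr, mulrN, mulNr); lra.
Qed.

Lemma compressed_leaf S v : (size S <= s < 1)%N ->
  exists2 T, compressed S (Leaf v) T & few_internal S (Leaf v) T.
Proof.
move=> size_S; have /nilP-> : size S == 0%N by lia.
exists (Leaf v); last by rewrite /few_internal /=; lia.
by split=> //; rewrite pending_dis_nil inner1 // mulr0 addr0.
Qed.

(** At most [3 * s] leaves are involved, so even losing all the dissimilarity of their pairs costs
    at most [lam] per unit of weight. *)
Lemma compressed_small S l r : binary (Node [:: l; r]) ->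
  uniq (S ++ leaves (Node [:: l; r])) ->
  (size S <= s < size (leaves (Node [:: l; r])))%N ->
  (size (leaves l) <= s)%N -> (size (leaves r) <= s)%N ->
  exists2 T, compressed S (Node [:: l; r]) T & few_internal S (Node [:: l; r]) T.
Proof.
set t := Node _ => bt uS /andP[size_S size_t] size_l size_r.
have size_t2 : (size (leaves t) <= 2 * s)%N by rewrite leaves_node2 size_cat; lia.
have ut : uniq (leaves t) by move: uS; rewrite cat_uniq => /and3P[].
have dis_t := tree_dis_le u_ge0 bt ut.
(* One leaf [v] is kept as the core; all others go into pieces around it. *)
case E : (leaves t) size_t => [//|v p] size_t.
have perm_S : perm_eq ((S ++ p) ++ leaves (Leaf v)) (S ++ leaves t).
  by rewrite E -catA perm_cat2l /= cats1 perm_rcons.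
have size_Sp : (size (S ++ p) <= d.+1 * k)%N.
  by move: size_t2; rewrite E size_cat /=; lia.
have uSp : uniq ((S ++ p) ++ leaves (Leaf v)) by rewrite (perm_uniq perm_S).
have Pv : all_nodes P (Leaf v) by [].
have [T [perm_T P_T size_T _]] :=
  flush_pieces u_ge0 u_diag q_gt0 size_Sp uSp P_le Pv.
exists T; last first.
  apply: (@leq_trans (s.+1 * (2 * (d + q).+1))).
    by rewrite leq_mul2l; move: size_T => /=; clear; lia.
  by rewrite mulnC leq_mul2l E size_cat; move: size_t; clear; lia.
split=> //; first exact: perm_trans perm_T perm_S.
apply: (@le_trans _ _ (lam * inner (S ++ leaves t))); last first.
  by rewrite lerDr tree_dis_ge0.
apply: (@le_trans _ _ (inner (S ++ leaves t) * (size (S ++ leaves t))%:R)).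
  rewrite /pending_dis mulrBl addrC -addrA gerDl addrC subr_le0.
  apply: le_trans dis_t _; rewrite ler_wpM2l ?inner_ge0 // ler_nat.
  by rewrite size_cat leq_addl.
rewrite mulrC ler_wpM2r ?inner_ge0 //; apply: le_trans lam_ge3s.
by rewrite -natrM ler_nat size_cat; move: size_S size_t2; clear; lia.
Qed.

(** Pairs split at this node keep their weight exactly, so each side is compressed with nothing
    pending and [S] is flushed above the joined tree. *)
Lemma compressed_both_big S l r :
  uniq (S ++ leaves (Node [:: l; r])) -> (size S <= s)%N ->
  (exists2 T, compressed [::] l T & few_internal [::] l T) ->
  (exists2 T, compressed [::] r T & few_internal [::] r T) ->
  exists2 T, compressed S (Node [:: l; r]) T & few_internal S (Node [:: l; r]) T.
Proof.
move=> uS size_S [Tl [/= perm_l P_l]]; rewrite pending_dis_nil => dis_l size_l.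
move=> [Tr [/= perm_r P_r]]; rewrite pending_dis_nil => dis_r size_r.
have perm_lr : perm_eq (leaves Tl ++ leaves Tr) (leaves l ++ leaves r).
  by apply: perm_cat.
have ulr : uniq (leaves l ++ leaves r).
  by move: uS; rewrite leaves_node2 cat_uniq => /and3P[].
have comp : compressed [::] (Node [:: l; r]) (Node [:: Tl; Tr]).
  split; rewrite ?cat0s ?leaves_node2 //=; first by rewrite P_pair P_l P_r.
  rewrite pending_dis_nil !tree_dis_node2 ?(perm_uniq perm_lr) //.
  rewrite inner_cat (perm_size perm_l) (perm_size perm_r).
  have -> : cross (leaves Tl) (leaves Tr) = cross (leaves l) (leaves r).
    exact: cross_perm.
  have : 0 <= lam * cross (leaves l) (leaves r).
    by rewrite mulr_ge0 ?cross_ge0 // (le_trans _ lam_ge3s) // mulr_ge0.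
  by lra.
have size_S2 : (size S <= 2 * s)%N by apply: leq_trans size_S (leq_pmull _ _).
have [T comp_T size_T] := flush_compressed size_S2 uS comp.
exists T => //; rewrite /few_internal leaves_node2 size_cat.
apply: (@leq_trans (s.+1 * ((n_internal Tl + (d + q).+1) +
                            (n_internal Tr + (d + q).+1)))).
  by rewrite leq_mul2l; move: size_T => /=; clear; lia.
rewrite mulnDr; apply: leq_trans (leq_add size_l size_r) _.
by rewrite !cat0s -mulnDr leq_pmul2l // size_cat leq_addl.
Qed.

Lemma compressed_one_small S l r :
  binary l -> uniq (S ++ leaves (Node [:: l; r])) -> (size S <= s)%N ->
  (size (leaves l) <= s)%N ->
  (forall S', uniq (S' ++ leaves r) -> (size S' <= s)%N ->
     exists2 T, compressed S' r T & few_internal S' r T) ->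
  exists2 T, compressed S (Node [:: l; r]) T & few_internal S (Node [:: l; r]) T.
Proof.
move=> bl; rewrite leaves_node2 => uS size_S size_l IH.
have ulr : uniq (leaves l ++ leaves r).
  by move: uS; rewrite cat_uniq => /and3P[].
have ul : uniq (leaves l) by move: ulr; rewrite cat_uniq => /and3P[].
have ur : uniq (leaves r) by move: ulr; rewrite cat_uniq => /and3P[].
rewrite catA in uS.
(* Letting [leaves l] become pending can only raise the account: pairs meeting [l] are then charged
   the full size, [S] included. *)
have pend : pending_dis S (Node [:: l; r]) <= pending_dis (S ++ leaves l) r.
  rewrite /pending_dis leaves_node2 tree_dis_node2 // -size_cat -catA.
  rewrite [inner (leaves l ++ leaves r)]inner_cat.
  set m := (size (S ++ _))%:R.
  have : tree_dis l <= inner (leaves l) * m.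
    apply: le_trans (tree_dis_le u_ge0 bl ul) _.
    by rewrite ler_wpM2l ?inner_ge0 // ler_nat !size_cat; lia.
  have : cross (leaves l) (leaves r) * (size (leaves l ++ leaves r))%:R
           <= cross (leaves l) (leaves r) * m.
    by rewrite ler_wpM2l ?cross_ge0 // ler_nat !size_cat; lia.
  by rewrite !(mulrDl, mulrBl, mulNr, opprD); lra.
suff [T [perm_T P_T dis_T] size_T] : exists2 T,
    compressed (S ++ leaves l) r T & few_internal (S ++ leaves l) r T.
  exists T; last by rewrite /few_internal leaves_node2 catA.
  by split; rewrite // leaves_node2 catA //; apply: le_trans pend dis_T.
(* Within [s] pending leaves no node is created; beyond, there are between [s.+1] and [2 * s] of
   them, enough to pay for a flush. *)
have [size_Sl|size_Sl] := leqP (size (S ++ leaves l)) s; first exact: IH.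
have [T0 comp_T0 size_T0] := IH [::] ur (leq0n s).
have size_Sl2 : (size (S ++ leaves l) <= 2 * s)%N by rewrite size_cat; lia.
have [T comp_T size_T] := flush_compressed size_Sl2 uS comp_T0.
exists T => //; rewrite /few_internal size_cat.
apply: (@leq_trans (s.+1 * ((d + q).+1 + (n_internal T0 + (d + q).+1)))).
  by rewrite leq_mul2l; move: size_T; clear; lia.
rewrite [leqLHS]mulnDr [leqRHS]mulnDr leq_add // mulnC -mulnA mulnCA leq_pmul2l //.
by move: size_Sl; clear; lia.
Qed.

Lemma compressed_swap S l r T : uniq (leaves l ++ leaves r) ->
  compressed S (Node [:: l; r]) T /\ few_internal S (Node [:: l; r]) T ->
  compressed S (Node [:: r; l]) T /\ few_internal S (Node [:: r; l]) T.
Proof.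
move=> ulr; have perm_lr : perm_eq (leaves r ++ leaves l) (leaves l ++ leaves r).
  exact: permEl (perm_catC _ _).
have perm_S : perm_eq (S ++ (leaves r ++ leaves l)) (S ++ (leaves l ++ leaves r)).
  by rewrite perm_cat2l.
rewrite /compressed /few_internal /pending_dis !leaves_node2.
rewrite !tree_dis_node2 ?(perm_uniq perm_lr) // crossC addnC [tree_dis r + _]addrC.
rewrite (inner_perm _ perm_lr) (inner_perm _ perm_S) (perm_size perm_S).
by rewrite !(permPr perm_S).
Qed.

(* The potential 2 (d + q + 1) |S ++ t| / (s + 1) pays for the internal nodes:
   every flush of at least s + 1 pending leaves, and every node with two
   children of more than s leaves, costs at most d + q + 1 nodes. *)
Lemma compress_tree t : binary t -> forall S,
  uniq (S ++ leaves t) -> (size S <= s < size (leaves t))%N ->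
  exists2 T, compressed S t T & few_internal S t T.
Proof.
move: t; apply: binary_ind => [v|l r bl br IHl IHr] S uS /[dup] size_t /andP[size_S _].
  exact: compressed_leaf.
have ulr : uniq (leaves l ++ leaves r).
  by move: uS; rewrite leaves_node2 cat_uniq => /and3P[].
have [size_l|size_l] := leqP (size (leaves l)) s;
  have [size_r|size_r] := leqP (size (leaves r)) s.
- by apply: compressed_small; rewrite // /binary /= andbT; apply/andP.
- by apply: compressed_one_small => // S' uS' size_S'; apply: IHr; rewrite ?size_S'.
- have uS' : uniq (S ++ leaves (Node [:: r; l])).
    rewrite (perm_uniq (_ : perm_eq _ (S ++ leaves (Node [:: l; r])))) //.
    by rewrite !leaves_node2 perm_cat2l perm_catC.
  have IHl' S' : uniq (S' ++ leaves l) -> (size S' <= s)%N ->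
      exists2 T, compressed S' l T & few_internal S' l T.
    by move=> uS'' size_S'; apply: IHl; rewrite ?size_S'.
  have [T cT fT] := compressed_one_small br uS' size_S size_r IHl'.
  have url : uniq (leaves r ++ leaves l) by rewrite uniq_catC.
  by have [] := compressed_swap url (conj cT fT); exists T.
- move: ulr; rewrite cat_uniq => /and3P[ul _ ur].
  by apply: compressed_both_big => //; [apply: IHl | apply: IHr].
Qed.

End Compression.

(** * The value of an optimal tree, and the choice of the parameters *)

Definition pair_weight (R : realFieldType) n (w : 'I_n -> 'I_n -> R) (i j : 'I_n) : R :=
  if (i < j)%N then w i j else 0.

Lemma tree_dis_pair_weight (R : realFieldType) n (w : 'I_n -> 'I_n -> R) t :
  perm_eq (leaves t) (enum 'I_n) -> tree_dis (pair_weight w) t = dis w t.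
Proof.
move=> perm_t; rewrite /tree_dis /dis (perm_big _ perm_t) big_enum /=.
apply: eq_bigr => i _; rewrite (perm_big _ perm_t) big_enum /= [RHS]big_mkcond.
by apply: eq_bigr => j _; rewrite /pair_weight; case: ifP; rewrite ?mul0r.
Qed.

Lemma binary_caterpillar n v (p : seq 'I_n) :
  exists2 t : hctree n, binary t & leaves t = v :: p.
Proof.
elim: p v => [|v' p IH] v; first by exists (Leaf v).
have [t bt leaves_t] := IH v'; exists (Node [:: Leaf v; t]).
  by rewrite /binary /= andbT.
by rewrite leaves_node2 leaves_t.
Qed.

Lemma is_binary_hctreeE n (t : hctree n) :
  binary t -> perm_eq (leaves t) (enum 'I_n) -> is_binary_hctree t.
Proof.
by move=> bt perm_t; split=> //; split=> //; apply: all_nodes_sub bt => ts /eqP->.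
Qed.

(* Cutting along a bipartition of weight at least half at the root gives every
   cut pair the weight n. *)
Lemma optimal_dis_ge (R : realFieldType) n (u : 'I_n -> 'I_n -> R) (t : hctree n) :
  (forall i j, 0 <= u i j) -> (forall i, u i i = 0) ->
  (forall T, is_binary_hctree T -> tree_dis u T <= tree_dis u t) ->
  n%:R * inner u (enum 'I_n) <= 2 * tree_dis u t.
Proof.
move=> u_ge0 u_diag opt.
have dis_ge0 := tree_dis_ge0 u_ge0 t.
(* With [d = 0], [q = 2], [k = n] there are two pieces of unrestricted size, and the pairs inside
   them carry at most half of the weight. *)
have [|ps [+ perm_ps _]] := @balanced_pieces _ _ _ u_ge0 u_diag 0 2 n (enum 'I_n) isT.
  by rewrite size_enum_ord mul1n.
case: ps perm_ps => [|A [|B []]] //= perm_AB _; rewrite cats0 in perm_AB.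
rewrite !big_cons big_nil addr0 -(inner_perm _ perm_AB) inner_cat => inner_AB.
have cross_half : inner u A + inner u B <= cross u A B by lra.
(* An empty piece gives no tree on its side, but then [cross] is 0 and so is the total weight. *)
have trivial_case : cross u A B = 0 ->
    n%:R * (inner u A + inner u B + cross u A B) <= 2 * tree_dis u t.
  move=> cross0; have := inner_ge0 u_ge0 A; have := inner_ge0 u_ge0 B.
  move=> ? ?; have -> : inner u A + inner u B + cross u A B = 0 by lra.
  by rewrite mulr0 mulr_ge0.
case: A => [|a A] in perm_AB inner_AB cross_half trivial_case *.
  by apply: trivial_case; rewrite /cross big_nil.
case: B => [|b B] in perm_AB inner_AB cross_half trivial_case *.
  by apply: trivial_case; rewrite /cross big1 // => i _; rewrite big_nil.
have [tA bA leavesA] := binary_caterpillar a A.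
have [tB bB leavesB] := binary_caterpillar b B.
have bAB : binary (Node [:: tA; tB]) by rewrite /binary /= andbT; apply/andP.
have perm_tAB : perm_eq (leaves (Node [:: tA; tB])) (enum 'I_n).
  by rewrite leaves_node2 leavesA leavesB.
have uAB : uniq (leaves tA ++ leaves tB).
  by rewrite -leaves_node2 (perm_uniq perm_tAB) enum_uniq.
have := opt _ (is_binary_hctreeE bAB perm_tAB).
rewrite tree_dis_node2 // -size_cat -leaves_node2 (perm_size perm_tAB).
rewrite size_enum_ord leavesA leavesB.
have := tree_dis_ge0 u_ge0 tA; have := tree_dis_ge0 u_ge0 tB.
have : 0 <= n%:R * (cross u (a :: A) (b :: B) - (inner u (a :: A) + inner u (b :: B))).
  by rewrite mulr_ge0 ?subr_ge0.
by rewrite !mulrDr mulrN mulrDr mulrC; lra.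
Qed.

(* R need not be archimedean, hence the bound N. *)
Lemma exists_floor (R : realFieldType) (x : R) (N : nat) :
  0 <= x <= N%:R -> exists m : nat, m%:R <= x < m.+1%:R.
Proof.
move=> /andP[x_ge0 x_le].
have exP : exists m : nat, m%:R <= x by exists 0%N.
have boundP (m : nat) : m%:R <= x -> (m <= N)%N.
  by move=> mx; rewrite -(ler_nat R); apply: le_trans mx x_le.
have [m mx max_m] := ex_maxnP exP boundP.
exists m; rewrite mx ltNge; apply/negP => /max_m; lia.
Qed.

Theorem theorem4 :
  exists C : nat, (0 < C)%N /\
  forall (R : realFieldType) (n : nat) (w : 'I_n -> 'I_n -> R)
         (TO : hctree n) (eps : R),
    (forall i j : 'I_n, i != j -> 0 <= w i j <= 1) ->
    is_binary_hctree TO ->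
    (forall T : hctree n, is_binary_hctree T -> dis w T <= dis w TO) ->
    0 < eps -> eps < 1 -> 1 <= eps ^+ 2 * n%:R ->
    exists Tt : hctree n,
      [/\ is_hctree Tt,
          (C%:R)^-1 / eps ^+ 2 <= (n_internal Tt)%:R <= C%:R / eps ^+ 2,
          all_nodes (fun ts => (size ts)%:R <= 3 * eps ^+ 2 * n%:R) Tt
        & (1 - eps) * dis w TO <= dis w Tt].
Proof.
(* 264 is 24 times 11: 24 from the factor 2 of the potential and s + 1 > eps n / 12, and 11 from 2q
   + 1 <= 11 / eps. *)
exists 264%N; split=> // R n w TO eps w01 [[_ perm_TO] bTO] opt eps_gt0 eps_lt1 big_n.
have uTO : uniq (leaves TO) by rewrite (perm_uniq perm_TO) enum_uniq.
have size_TO : size (leaves TO) = n by rewrite (perm_size perm_TO) size_enum_ord.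
set u := pair_weight w.
have u_ge0 i j : 0 <= u i j.
  rewrite /u /pair_weight; case: ifP => // ij.
  have ne_ij : i != j by apply: contraTneq ij => ->; rewrite ltnn.
  by have /andP[] := w01 i j ne_ij.
have u_diag i : u i i = 0 by rewrite /u /pair_weight ltnn.
have {}opt T : is_binary_hctree T -> tree_dis u T <= tree_dis u TO.
  by move=> hT; rewrite !tree_dis_pair_weight ?opt //; case: hT => -[].
have opt_ge := optimal_dis_ge u_ge0 u_diag opt.
have n_ge0 : 0 <= n%:R :> R by [].
have n_gt1 : 1 < n%:R :> R by nra.
have eps_n : eps * n%:R <= n%:R by rewrite ler_piMl // ltW.
(* Then 3s <= eps n / 4; with n / q <= eps n / 4 this allows [lam] = eps n / 2. *)
have [s /andP[s_le s_gt]] : exists s : nat, s%:R <= eps * n%:R / 12 < s.+1%:R.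
  by apply: (@exists_floor _ _ n); nra.
have inv_eps : 0 < eps^-1 by rewrite invr_gt0.
have eps_ge0 := ltW eps_gt0.
have inv_ge0 := ltW inv_eps.
have mulV : eps * eps^-1 = 1 by rewrite divff // gt_eqF.
have inv_le : eps^-1 <= n%:R.
  apply: (@le_trans _ _ (eps * n%:R)); last by nra.
  by rewrite -[leLHS]mul1r ler_pdivrMr // mulrAC -expr2.
have inv_ge1 : 1 <= eps^-1 by rewrite invf_ge1 // ltW.
have [q0 /andP[q0_le q0_gt]] : exists q : nat, q%:R <= 4 * eps^-1 < q.+1%:R.
  by apply: (@exists_floor _ _ (4 * n)); rewrite natrM; lra.
have [k /andP[k_le k_gt]] : exists k : nat, k%:R <= eps ^+ 2 * n%:R < k.+1%:R.
  apply: (@exists_floor _ _ n); apply/andP; split; first by lra.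
  by rewrite ler_piMl // exprn_ile1 // ltW.
set q := q0.+1 in q0_gt.
have k_gt0 : (0 < k)%N by case: k k_gt {k_le} => // k1; lra.
have k_ge1 : 1 <= k%:R :> R by rewrite ler1n.
have eps_q : 4 <= eps * q%:R.
  have : 0 <= eps * (q%:R - 4 * eps^-1) by rewrite mulr_ge0 ?subr_ge0 ?ltW.
  by rewrite mulrBr mulrCA mulV; lra.
(* The choice is d = q. As k >= 1 is a floor, k >= eps^2 n / 2, so q k >= 2 eps n, well above 3s. *)
have s_k : (3 * s <= q.+1 * k)%N.
  rewrite -(ler_nat R) !natrM -[q.+1%:R]natr1.
  have k_half : eps ^+ 2 * n%:R <= 2 * k%:R by move: k_gt; rewrite -natr1; lra.
  have : 4 * eps^-1 * (eps ^+ 2 * n%:R) <= q%:R * (2 * k%:R).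
    by apply: ler_pM; rewrite ?(ltW q0_gt) // mulr_ge0 ?exprn_ge0.
  have -> : 4 * eps^-1 * (eps ^+ 2 * n%:R) = 4 * (eps * n%:R).
    by field; rewrite gt_eqF.
  have : 0 <= eps * n%:R by rewrite mulr_ge0.
  by move: s_le k_ge1; lra.
have lam_ge : 3 * s%:R + n%:R / q%:R <= eps * n%:R / 2.
  have : n%:R / q%:R <= eps * n%:R / 4.
    rewrite ler_pdivrMr ?ltr0n //.
    have : 0 <= n%:R * (eps * q%:R - 4) by rewrite mulr_ge0 // subr_ge0.
    by lra.
  by move: s_le; lra.
have s_lt_n : (s < size (leaves TO))%N.
  by rewrite size_TO -(ltr_nat R); move: s_le eps_n n_gt1; lra.
pose P (ts : seq (hctree n)) := (1 < size ts <= k.+1)%N.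
have P_pair l r : P [:: l; r] by [].
have [|T [/= perm_T P_T dis_T] size_T] :=
  compress_tree (S := [::]) u_ge0 u_diag (isT : 0 < q)%N
  s_k (fun ts (Pts : P ts) => Pts) P_pair lam_ge bTO uTO; first by rewrite s_lt_n.
have perm_Te : perm_eq (leaves T) (enum 'I_n) := perm_trans perm_T perm_TO.
exists T; split.
- split=> //; apply: all_nodes_sub P_T => ts; by case/andP.
- have I_ge0 : 0 <= (n_internal T)%:R :> R by [].
  have eps2_gt0 : 0 < eps ^+ 2 by rewrite exprn_gt0.
  apply/andP; split.
    have : (n <= 1 + k * n_internal T)%N.
      rewrite -{1}size_TO -(perm_size perm_T); apply: leaf_count_le.
      by apply: all_nodes_sub P_T => ts /andP[].
    rewrite -(ler_nat R) natrD natrM ler_pdivrMr // => n_le.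
    have kI_le : k%:R * (n_internal T)%:R <= eps ^+ 2 * n%:R * (n_internal T)%:R.
      by rewrite ler_wpM2r.
    have n_ge2 : 2 <= n%:R :> R by rewrite (ler_nat R 2) -(ltr1n R).
    (* Since n >= 2, n - 1 is at least n / 2; the resulting bound 1/2 exceeds 1/264. *)
    have : n%:R * 2^-1 <= n%:R * ((n_internal T)%:R * eps ^+ 2).
      by move: n_le kI_le n_ge2; lra.
    by rewrite ler_pM2l ; lra.
  move: size_T; rewrite /few_internal cat0s size_TO -(ler_nat R) !natrM natrD.
  have : (q + q).+1%:R <= 11 * eps^-1 by rewrite -natr1 natrD /q -natr1; lra.
  move: ((q + q).+1%:R) (ler0n R (q + q).+1) => Q Q_ge0 Q_le size_T.
  rewrite ler_pdivlMr //.
  have : n%:R * (eps * (n_internal T)%:R) <= n%:R * (24 * Q).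
    have : 0 <= (s.+1%:R - eps * n%:R / 12) * (n_internal T)%:R.
      by rewrite mulr_ge0 // subr_ge0 ltW.
    have : 0 <= s.+1%:R * Q by rewrite mulr_ge0.
    by lra.
  rewrite ler_pM2l; last by lra.
  move=> eps_I; have : eps * (eps * (n_internal T)%:R) <= eps * (24 * (11 * eps^-1)).
    by rewrite ler_wpM2l //; lra.
  have -> : eps * (24 * (11 * eps^-1)) = 264 by field; rewrite gt_eqF.
  by rewrite mulrA -expr2 mulrC.
- apply: all_nodes_sub P_T => ts /andP[_]; rewrite -(ler_nat R) -natr1 => ts_le.
  by nra.
rewrite -!tree_dis_pair_weight // -/u; move: dis_T; rewrite pending_dis_nil.
(* By [opt_ge], the loss of eps n / 2 per unit of weight is at most an eps fraction of the
   optimum. *)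
rewrite (inner_perm _ perm_TO); nra.
Qed.
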